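(* There is a constant $C>0$ such that every string $s$ of length $n\ge 2$ contains at most $C\,n\log n$ right closed repeats and at most $C\,n\log n$ left closed repeats. (That is, the numbers of left closed repeats and of right closed repeats in a string of length $n$ are $O(n\log n)$.)
   Context: Let $s=s[1]s[2]\cdots s[n]$ be a string over some alphabet; $s[i\,..\,j]$ denotes the substring $s[i]s[i+1]\cdots s[j]$. A string $t$ occurs in $s$ at position $i$ if $s[i\,..\,i+|t|-1]=t$. A non-empty substring $s[i\,..\,j]$ is a right closed repeat (respectively, left closed repeat) if it has an occurrence $s[i'\,..\,j']=s[i\,..\,j]$ with $i'>i$ such that $s[i\,..\,j]$ does not occur at any of the positions $i+1,\dots,i'-1$, and either $j'=n$ or $s[j+1]\ne s[j'+1]$ (respectively, either $i=1$ or $s[i-1]\ne s[i'-1]$). The occurrence $s[i'\,..\,j']$ is called the next occurrence of $s[i\,..\,j]$. Repeats that are equal as strings but occur at different positions are counted as different. Logarithms are base 2. *)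

(* Defs.v *)
From mathcomp Require Import all_boot all_order all_algebra.
From mathcomp Require Import boolp reals exp.

Set Implicit Arguments.
Unset Strict Implicit.
Unset Printing Implicit Defensive.

(* Positions in a string [s] are 1-based: they are 1, ..., size s. *)

Section ClosedRepeats.
Variables (T : eqType) (s : seq T).
Implicit Types (t : seq T) (i j k : nat).

(* s[k]; [None] when k exceeds [size s].  The definitions below use it only at
   positions of [s]. *)
Definition letter k : option T := onth s k.-1.

(* s[i..j], for 1 <= i <= j <= size s.  When j exceeds [size s], this has fewer
   than j - i + 1 letters. *)
Definition substr i j : seq T := drop i.-1 (take j s).

(* For nonempty [t], the equality forces i + |t| - 1 <= size s. *)
Definition occurs_at t i : Prop := 0 < i /\ substr i (i + size t - 1) = t.

Definition next_occurrence i j i' j' : Prop :=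
  [/\ i < i', i' <= j' <= size s, substr i' j' = substr i j
    & forall k, i < k < i' -> ~ occurs_at (substr i j) k].

Definition right_closed_repeat i j : Prop :=
  0 < i <= j /\ j <= size s /\
  exists i' j', next_occurrence i j i' j' /\
    (j' = size s \/ letter j.+1 <> letter j'.+1).

Definition left_closed_repeat i j : Prop :=
  0 < i <= j /\ j <= size s /\
  exists i' j', next_occurrence i j i' j' /\
    (i = 1 \/ letter i.-1 <> letter i'.-1).

(* Repeats are counted as pairs (i, j) of end positions, hence equal strings at
   different positions count separately. *)
Definition num_right_closed_repeats : nat :=
  #|[set p : 'I_(size s).+1 * 'I_(size s).+1
      | `[< right_closed_repeat p.1 p.2 >]]|.

Definition num_left_closed_repeats : nat :=
  #|[set p : 'I_(size s).+1 * 'I_(size s).+1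
      | `[< left_closed_repeat p.1 p.2 >]]|.

End ClosedRepeats.

Definition log2 (R : realType) (x : R) : R := (ln x / ln 2)%R.

(* Main.v *)
(* Let lam i k be the length of the longest common prefix of the suffixes of s
   starting at i and k.  A right closed repeat at i is determined by its next
   occurrence i', and i' is a record: lam i k < lam i i' for all i < k < i'.
   Dually, a left closed repeat ending at j is a record for the longest common
   suffixes of prefixes, so both kinds are counted by the records of a function
   lam satisfying the ultrametric inequality on a set S of m positions.
   Taking d to be the least value of lam on pairs from S, S splits into A and B
   with lam = d across.  A record across the split must consist of neighbours
   in S, so there are at most 2 min(|A|, |B|) of them; all others are records
   of A or of B.  The recurrence f(a + b) <= f(a) + f(b) + 2 min(a, b) gives
   f(m) <= 2 m log m. *)
Require Import Defs.
From mathcomp Require Import all_boot all_order all_algebra.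
From mathcomp Require Import boolp reals exp zify.

Set Implicit Arguments.
Unset Strict Implicit.
Unset Printing Implicit Defensive.
Import Order.TTheory GRing.Theory Num.Theory.

(** * Counting records of an ultrametric similarity *)

Section Records.
Variable N : nat.
Implicit Types (A B S : {set 'I_N}) (x y z : 'I_N) (p : 'I_N * 'I_N).

Definition adjacent_in S p :=
  [&& p.1 \in S, p.2 \in S, p.1 < p.2
    & [forall z in S, ~~ (p.1 < z < p.2)]].

(** Within [S] each position has at most one successor and at most one predecessor, so each element
    of [A] lies in at most two neighbouring pairs. *)
Lemma card_adjacent_in_meeting S A :
  #|[set p | adjacent_in S p & (p.1 \in A) || (p.2 \in A)]| <= 2 * #|A|.
Proof.
pose P1 := [set p | adjacent_in S p & p.1 \in A].
pose P2 := [set p | adjacent_in S p & p.2 \in A].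
have -> : [set p | adjacent_in S p & (p.1 \in A) || (p.2 \in A)] = P1 :|: P2.
  by apply/setP => p; rewrite !inE andb_orr.
have no_between q z : adjacent_in S q -> z \in S -> ~~ (q.1 < z < q.2).
  by case/and4P => _ _ _ /forall_inP; apply.
have cardP1 : #|P1| <= #|A|.
  rewrite -(@card_in_imset _ _ (@fst _ _)).
    apply/subset_leq_card/subsetP => _ /imsetP[p + ->].
    by rewrite inE => /andP[].
  move=> [x y] [x' y'] /[!inE] /andP[adj _] /andP[adj' _] /= ex; subst x'.
  have [/= _ Sy lt_xy _] := and4P adj; have [/= _ Sy' lt_xy' _] := and4P adj'.
  have /= := no_between _ _ adj Sy'; have /= := no_between _ _ adj' Sy.
  by move=> *; congr pair; apply/val_inj => /=; lia.
have cardP2 : #|P2| <= #|A|.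
  rewrite -(@card_in_imset _ _ (@snd _ _)).
    apply/subset_leq_card/subsetP => _ /imsetP[p + ->].
    by rewrite inE => /andP[].
  move=> [y x] [y' x'] /[!inE] /andP[adj _] /andP[adj' _] /= ex; subst x'.
  have [/= Sy _ lt_xy _] := and4P adj; have [/= Sy' _ lt_xy' _] := and4P adj'.
  have /= := no_between _ _ adj Sy'; have /= := no_between _ _ adj' Sy.
  by move=> *; congr pair; apply/val_inj => /=; lia.
by rewrite (leq_trans (leq_card_setU _ _)) // mul2n -addnn leq_add.
Qed.

Variable lam : 'I_N -> 'I_N -> nat.
Hypothesis lamC : forall x y, lam x y = lam y x.
Hypothesis lam_ultra : forall x y z, minn (lam x y) (lam y z) <= lam x z.

Definition records S : {set 'I_N * 'I_N} :=
  [set p | [&& p.1 \in S, p.2 \in S, p.1 < p.2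
             & [forall z in S, (p.1 < z < p.2) ==> (lam p.1 z < lam p.1 p.2)]]].

Lemma records_sub S B p :
  B \subset S -> p \in records S -> p.1 \in B -> p.2 \in B -> p \in records B.
Proof.
move=> /subsetP BS /[!inE] /and4P[_ _ -> /forall_inP rec] -> -> /=.
by apply/forall_inP => z /BS; apply: rec.
Qed.

Lemma cross_record_adjacent S p :
    {in S &, forall x y, x != y -> lam p.1 p.2 <= lam x y} ->
  p \in records S -> adjacent_in S p.
Proof.
move=> min_p /[!inE] /and4P[S1 S2 lt12 /forall_inP rec].
rewrite /adjacent_in S1 S2 lt12; apply/forall_inP => z Sz; apply/negP => ltz.
have := implyP (rec z Sz) ltz; rewrite ltnNge min_p //.
by apply/eqP => ez; move: ltz; rewrite -ez ltnn.
Qed.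

Lemma records_split S : 1 < #|S| ->
  exists A B, [/\ A != set0, B != set0, A :|: B = S, [disjoint A & B]
    & #|records S| <= #|records A| + #|records B| + 2 * minn #|A| #|B|].
Proof.
case/card_gt1P => x0 [y0 [Sx0 Sy0 neq0]].
pose P p := [&& p.1 \in S, p.2 \in S & p.1 != p.2].
have P0 : P (x0, y0) by apply/and3P.
case: (arg_minnP (fun p => lam p.1 p.2) P0) => -[a b] /and3P[/= Sa Sb ab] minP.
have min_ab : {in S &, forall x y, x != y -> lam a b <= lam x y}.
  by move=> x y Sx Sy xy; apply: (minP (x, y)); apply/and3P.
(* [A] is the open ball around [a]; the centre is added by hand because [lam a a] may equal
   [lam a b]. *)
pose A := [set x in S | (x == a) || (lam a b < lam a x)].
pose B := S :\: A.
have AS : A \subset S by apply/subsetP => x /[!inE] /andP[].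
have BS : B \subset S by apply: subsetDl.
(* For [x = a] this is how [B] is cut out. Otherwise, if [lam x y] exceeded the minimum as [lam a x]
   does, so would [lam a y], forcing [y] into [A]. *)
have cross x y : x \in A -> y \in B -> lam x y = lam a b.
  rewrite !inE negb_and negb_or => /andP[Sx Ax] /andP[+ Sy].
  rewrite Sy /= -leqNgt => /andP[ya lay].
  have xy : x != y by apply: contraTneq Ax => ->; rewrite negb_or ya -leqNgt.
  apply/eqP; rewrite eqn_leq min_ab // andbT.
  case/predU1P: Ax => [-> // | lax].
  by have := leq_trans (lam_ultra a x y) lay; rewrite geq_min leqNgt lax.
exists A, B; split.
- by apply/set0Pn; exists a; rewrite inE Sa eqxx.
- by apply/set0Pn; exists b; rewrite !inE Sb eq_sym (negPf ab) ltnn.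
- by apply/setP => x; rewrite !inE; case: (x \in S); case: ((x == a) || _).
- by rewrite -setI_eq0 /B setDE setICA setICr setI0.
pose X := [set p in records S | ((p.1 \in A) && (p.2 \in B))
                              || ((p.1 \in B) && (p.2 \in A))].
have adjX p : p \in X -> adjacent_in S p.
  rewrite inE => /andP[rec c]; apply: cross_record_adjacent rec.
  suff -> : lam p.1 p.2 = lam a b by [].
  by case/orP: c => /andP[*]; [|rewrite lamC]; apply: cross.
(* A crossing pair has an endpoint on each side, so the count of neighbours applies to whichever
   side is smaller. *)
have cardX A' : (A' = A) \/ (A' = B) -> #|X| <= 2 * #|A'|.
  move=> eA'; apply: leq_trans (card_adjacent_in_meeting S A').
  apply/subset_leq_card/subsetP => p Xp; rewrite inE adjX //.
  by move: Xp; rewrite inE => /andP[_] /orP[]/andP[h1 h2];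
    case: eA' => ->; rewrite ?h1 ?h2 ?orbT.
have subU : records S \subset records A :|: records B :|: X.
  apply/subsetP => p rec; rewrite 2!in_setU.
  have [S1 S2] : p.1 \in S /\ p.2 \in S by move: rec; rewrite inE => /and4P[].
  have inB x : x \in S -> (x \in B) = (x \notin A).
    by move=> Sx; rewrite inE Sx andbT.
  have [A1|B1] := boolP (p.1 \in A); have [A2|B2] := boolP (p.2 \in A).
  - by rewrite (records_sub AS).
  - by rewrite [_ \in X]inE rec A1 inB // B2 orbT.
  - by rewrite [_ \in X]inE rec A2 (inB _ S1) B1 !orbT.
  - by rewrite (@records_sub S B) ?inB ?orbT.
apply: leq_trans (subset_leq_card subU) _.
apply: leq_trans (leq_card_setU _ _) _.
rewrite leq_add ?leq_card_setU //.
by case: (leqP #|A| #|B|) => _; apply: cardX; [left|right].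
Qed.

(** The bound [2 m log m] in exponential form, which keeps the induction in [nat]; [0 ^ 0 = 1]
    covers the empty set. *)
Lemma card_records S : 2 ^ #|records S| <= #|S| ^ (2 * #|S|).
Proof.
have [m] := ubnP #|S|; elim: m S => // m IH S /ltnSE leSm.
have [gt1|le1] := ltnP 1 #|S|; last first.
  suff -> : records S = set0 by rewrite cards0 expn0; case: #|S| le1 => [|[]].
  apply/setP => p; rewrite !inE; apply/negP => /and4P[S1 S2 lt12 _].
  by have := card_le1_eqP le1 _ _ S1 S2 => e; rewrite e ltnn in lt12.
have [A [B [A0 B0 eS dAB le]]] := records_split gt1.
have cS : #|S| = #|A| + #|B|.
  by rewrite -eS cardsU (disjoint_setI0 dAB) cards0 subn0.
move: A0 B0; rewrite -!card_gt0 => A0 B0.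
have {}IH := (IH A ltac:(lia), IH B ltac:(lia)).
apply: leq_trans (leq_pexp2l _ le) _ => //.
rewrite cS; case: IH; move: #|A| #|B| (#|records A|) (#|records B|) A0 B0.
move=> a b ra rb a0 b0 IHa IHb.
wlog leab : a b ra rb a0 b0 IHa IHb / a <= b.
  move=> W; case/orP: (leq_total a b) => le_ab; first exact: W.
  by rewrite minnC [ra + rb]addnC [a + b]addnC; apply: W.
(* [(2a)^(2a) b^(2b) <= (a+b)^(2a+2b)] since [2a <= a + b]. *)
rewrite (minn_idPl leab) addnAC mulnDr.
rewrite (expnD _ (ra + _)) (expnD _ ra) (expnD (a + b)) leq_mul //.
  apply: (@leq_trans ((a * 2) ^ (2 * a))); first by rewrite expnMn leq_mul.
  by rewrite leq_exp2r ?muln_gt0 // muln2 -addnn leq_add2l.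
by apply: leq_trans IHb _; rewrite leq_exp2r ?muln_gt0 // leq_addl.
Qed.

End Records.

(** * Longest common prefixes *)

Section CommonPrefix.
Variable T : eqType.
Implicit Types u v w : seq T.

Fixpoint lcp u v : nat :=
  match u, v with
  | x :: u', y :: v' => if x == y then (lcp u' v').+1 else 0
  | _, _ => 0
  end.

Lemma leq_lcp l u v :
  (l <= lcp u v) = [&& l <= size u, l <= size v & take l u == take l v].
Proof.
elim: u v l => [|x u IH] [|y v] [|l] //=.
  by rewrite andbF.
by rewrite eqseq_cons; case: (x == y); rewrite !ltnS ?IH // !andbF.
Qed.

Lemma lcpC u v : lcp u v = lcp v u.
Proof.
by elim: u v => [|x u IH] [|y v] //=; rewrite eq_sym IH.
Qed.

Lemma lcp_ultra u v w : minn (lcp u v) (lcp v w) <= lcp u w.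
Proof.
have := geq_minl (lcp u v) (lcp v w); have := geq_minr (lcp u v) (lcp v w).
rewrite !leq_lcp => /and3P[_ -> /eqP <-] /and3P[-> _ /eqP ->].
by rewrite eqxx.
Qed.

End CommonPrefix.

(** * From closed repeats to records *)

Section ClosedRepeatsAreRecords.
Variables (T : eqType) (s : seq T).
Implicit Types i j k : nat.

Lemma size_substr i j : 0 < i <= j -> j <= size s ->
  size (substr s i j) = j - i + 1.
Proof. by move=> /andP[? ?] jn; rewrite size_drop size_takel //; lia. Qed.

Lemma substr_take_drop i j :
  0 < i <= j -> substr s i j = take (j - i + 1) (drop i.-1 s).
Proof.
by move=> /andP[? ?]; rewrite take_drop /substr; congr (drop _ (take _ _)); lia.
Qed.

Lemma substr_take_rev i j : 0 < i <= j -> j <= size s ->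
  substr s i j = rev (take (j - i + 1) (rev (take j s))).
Proof.
move=> /andP[? ?] jn; rewrite take_rev revK size_takel // /substr.
by congr (drop _ _); lia.
Qed.

Definition suffix_lcp i k := lcp (drop i.-1 s) (drop k.-1 s).
(** Longest common suffix of the prefixes ending at [j] and [k]; reversal turns it into a common
    prefix. *)
Definition prefix_lcp j k := lcp (rev (take j s)) (rev (take k s)).

(** Equality of the two occurrences bounds the common prefix from below, closedness bounds it from
    above, and a long common prefix at an intermediate [k] would be an earlier occurrence. *)
Lemma right_closed_repeat_record i j : right_closed_repeat s i j ->
  exists i', [/\ i < i', i' <= size s, suffix_lcp i i' = j - i + 1
    & forall k, i < k < i' -> suffix_lcp i k < j - i + 1].
Proof.
case=> i0j [jn [i' [j' [[ii' /andP[i'j' j'n] eq_sub no_occ] closed]]]].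
have i'0j' : 0 < i' <= j' by lia.
have eq_len : j' - i' + 1 = j - i + 1 by rewrite -!size_substr // eq_sub.
exists i'; split; [by []|exact: leq_trans j'n| |].
- apply/eqP; rewrite eqn_leq andbC leq_lcp !size_drop; apply/andP; split.
    rewrite -substr_take_drop // -[in take _ (drop i'.-1 s)]eq_len.
    by rewrite -substr_take_drop // eq_sub eqxx andbT; lia.
  rewrite leqNgt leq_lcp !size_drop; apply/negP => /and3P[_ lt /eqP eq_take].
  (* If [j' = size s], the suffix at [i'] is too short for a longer match. *)
  case: closed => [|]; [by lia|apply].
  (* The match is one letter longer than the repeat: compare its last letters, [s[j+1]] and
     [s[j'+1]]. Mapping by [some] makes [None] the default, as in [onth]. *)
  have := congr1 (fun t => nth None (map some t) (j - i + 1)) eq_take.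
  rewrite /letter !onthE !map_take !nth_take // !map_drop !nth_drop.
  by congr (nth _ _ _ = nth _ _ _); lia.
- move=> k ltk; rewrite ltnNge leq_lcp !size_drop.
  apply/negP => /and3P[_ lek /eqP eq_take]; apply: (no_occ k ltk).
  have k0 : 0 < k by lia.
  split=> //; rewrite size_substr // !substr_take_drop ?eq_take; [|lia|lia].
  by congr (take _ _); lia.
Qed.

Lemma left_closed_repeat_record i j : left_closed_repeat s i j ->
  exists j', [/\ j < j', j' <= size s, prefix_lcp j j' = j - i + 1
    & forall k, j < k < j' -> prefix_lcp j k < j - i + 1].
Proof.
case=> i0j [jn [i' [j' [[ii' /andP[i'j' j'n] eq_sub no_occ] closed]]]].
have i'0j' : 0 < i' <= j' by lia.
have eq_len : j' - i' + 1 = j - i + 1 by rewrite -!size_substr // eq_sub.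
exists j'; split; [by lia|by []| |].
- apply/eqP; rewrite eqn_leq andbC leq_lcp !size_rev !size_takel //.
  apply/andP; split.
    rewrite -(inj_eq (can_inj revK)) -substr_take_rev //.
    rewrite -[in take _ (rev (take j' s))]eq_len -substr_take_rev //.
    by rewrite eq_sub eqxx andbT; lia.
  rewrite leqNgt leq_lcp !size_rev !size_takel //.
  apply/negP => /and3P[lt lt' /eqP eq_take].
  (* If [i = 1], the prefix ending at [j] is the repeat itself and has no further letter to
     match. *)
  case: closed => [|]; [by lia|apply].
  have := congr1 (fun t => nth None (map some t) (j - i + 1)) eq_take.
  rewrite /letter !onthE !map_take !nth_take // !map_rev.
  rewrite !nth_rev ?size_map ?size_takel //.
  rewrite !map_take !nth_take; [|lia|lia].
  by congr (nth _ _ _ = nth _ _ _); lia.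
- move=> k ltk; have kn : k <= size s by lia.
  rewrite ltnNge leq_lcp !size_rev !size_takel //.
  apply/negP => /and3P[_ lek /eqP eq_take].
  (* The start of the occurrence that would end at [k]. *)
  apply: (no_occ (k - (j - i + 1)).+1); first by lia.
  split=> //; rewrite size_substr // !substr_take_rev ?eq_take //; try lia.
  have -> : (k - (j - i + 1)).+1 + (j - i + 1) - 1 = k by lia.
  by congr (rev (take _ _)); lia.
Qed.

Let position := 'I_(size s).+1.
Implicit Types D : {set position * position}.

(** [h] rebuilds a repeat from its record, so there are at least as many records as repeats. The
    index 0 is not a position of [s]; removing it leaves exactly [size s] of them. *)
Lemma card_bound_of_records (u : nat -> seq T)
    (h : position * position -> position * position) D :
    (forall p, p \in D -> exists2 q,
       q \in records (fun x y : position => lcp (u x) (u y)) [set~ ord0]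
       & p = h q) ->
  2 ^ #|D| <= size s ^ (2 * size s).
Proof.
move=> D_h.
have cS : #|[set~ ord0 : position]| = size s by rewrite cardsC1 card_ord.
have := @card_records _ (fun x y : position => lcp (u x) (u y))
  (fun x y => lcpC _ _) (fun x y z => lcp_ultra _ _ _) [set~ ord0].
rewrite cS; apply: leq_trans; rewrite leq_exp2l //.
apply: leq_trans (leq_imset_card h _); apply/subset_leq_card/subsetP => p.
by case/D_h => q Rq ->; apply: imset_f.
Qed.

Lemma num_right_closed_repeats_bound :
  2 ^ num_right_closed_repeats s <= size s ^ (2 * size s).
Proof.
pose h (q : position * position) : position * position :=
  (q.1, inord (q.1 + suffix_lcp q.1 q.2).-1).
apply: (@card_bound_of_records (fun i => drop i.-1 s) h) => -[i j].
rewrite inE => /asboolP/= cl.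
have [i0j _] := cl.
have [i' [ii' i'n eq_lcp rec]] := right_closed_repeat_record cl.
have i'E : (inord i' : position) = i' :> nat by rewrite inordK.
exists (i, inord i').
  rewrite inE /= i'E !in_setC1 -!val_eqE /= i'E ii'.
  apply/and4P; split=> //; try lia.
  apply/forall_inP => k _; apply/implyP => ltk.
  by move: eq_lcp; rewrite /suffix_lcp => ->; apply: rec.
rewrite /h /= i'E eq_lcp; congr pair; apply/val_inj => /=.
by rewrite inordK; have := ltn_ord j; lia.
Qed.

Lemma num_left_closed_repeats_bound :
  2 ^ num_left_closed_repeats s <= size s ^ (2 * size s).
Proof.
pose h (q : position * position) : position * position :=
  (inord (q.1 - prefix_lcp q.1 q.2).+1, q.1).
apply: (@card_bound_of_records (fun j => rev (take j s)) h) => -[i j].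
rewrite inE => /asboolP/= cl.
have [i0j _] := cl.
have [j' [jj' j'n eq_lcp rec]] := left_closed_repeat_record cl.
have j'E : (inord j' : position) = j' :> nat by rewrite inordK.
exists (j, inord j').
  rewrite inE /= j'E !in_setC1 -!val_eqE /= j'E jj'.
  apply/and4P; split=> //; try lia.
  apply/forall_inP => k _; apply/implyP => ltk.
  by move: eq_lcp; rewrite /prefix_lcp => ->; apply: rec.
rewrite /h /= j'E eq_lcp; congr pair; apply/val_inj => /=.
by rewrite inordK; have := ltn_ord i; lia.
Qed.

End ClosedRepeatsAreRecords.

(** * Passing to logarithms *)

Local Open Scope ring_scope.

Lemma le_log2_of_expn (R : realType) (c m n : nat) : (0 < n)%N ->
  (2 ^ c <= n ^ m)%N -> c%:R <= m%:R * log2 (n%:R : R).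
Proof.
move=> n0 le; have ln2 : 0 < ln (2 : R) by rewrite ln_gt0 // ltr1n.
rewrite /log2 mulrA ler_pdivlMr // !mulr_natl -!lnXn ?ltr0n //.
by rewrite ler_ln ?posrE ?exprn_gt0 ?ltr0n // -!natrX ler_nat.
Qed.

Theorem theorem1 (R : realType) :
  exists C : R, 0 < C /\
    forall (T : eqType) (n : nat) (s : seq T),
      size s = n -> (2 <= n)%N ->
      (num_right_closed_repeats s)%:R <= C * n%:R * log2 (n%:R : R) /\
      (num_left_closed_repeats s)%:R <= C * n%:R * log2 (n%:R : R).
Proof.
(* The constant is the factor 2 in the exponent [2 * size s]. *)
exists 2; split; first by rewrite ltr0n.
move=> T n s <- n2; have n0 : (0 < size s)%N by apply: ltnW.
rewrite -natrM; split; apply: le_log2_of_expn => //.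
- exact: num_right_closed_repeats_bound.
- exact: num_left_closed_repeats_bound.
Qed.
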